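(* For each choice of the sign $\pm$, the Diophantine equation $x^3\pm y^3=a^6+b^6$ has infinitely many nontrivial solutions $(x,y,a,b)$ in positive integers.
   Context: A quadruple $(x,y,a,b)$ of integers is called a nontrivial solution of an equation $x^3\pm y^3=a^k\pm b^k$ (signs fixed) if $\gcd(x,y,a,b)=1$ and no partial sum in the expression $x^3\pm y^3-(a^k\pm b^k)$ vanishes. *)

(* Defs.v *)
From mathcomp Require Import all_boot all_order all_algebra.
From mathcomp Require Import boolp classical_sets functions cardinality.

Set Implicit Arguments.
Unset Strict Implicit.
Unset Printing Implicit Defensive.

Import Order.TTheory GRing.Theory Num.Theory.
Local Open Scope ring_scope.

(* The four signed terms of x^3 ± y^3 - (a^k ± b^k); the two signs are
   (-1) ^+ s and (-1) ^+ t, so [false] stands for + and [true] for -. *)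
Definition terms (s t : bool) (k : nat) (x y a b : int) : 4.-tuple int :=
  [tuple x ^+ 3; (-1) ^+ s * y ^+ 3; - a ^+ k; - ((-1) ^+ t * b ^+ k)].

(* Partial sums are the sums over nonempty proper subsets of the four terms. *)
Definition no_vanishing_partial_sum (s t : bool) (k : nat) (x y a b : int) :=
  forall A : {set 'I_4}, A != finset.set0 -> A != [set: 'I_4]%SET ->
    \sum_(i in A) tnth (terms s t k x y a b) i != 0.

Definition nontrivial_solution (s t : bool) (k : nat) (x y a b : int) : Prop :=
  [/\ x ^+ 3 + (-1) ^+ s * y ^+ 3 = a ^+ k + (-1) ^+ t * b ^+ k,
      gcdz (gcdz x y) (gcdz a b) = 1
    & no_vanishing_partial_sum s t k x y a b].

(* Main.v *)
Require Import Defs.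
From mathcomp Require Import all_boot all_order all_algebra.
From mathcomp Require Import boolp classical_sets functions cardinality.
From mathcomp Require Import zify ring lra.

(** With [A = quad m n], [B = quad n m], [X = quart m n] and [Y = quart n m] one
    has [n X^3 + m Y^3 = n A^6 + m B^6], so [m = p^6] and [n = q^6] give the
    solution [(q^2 X, p^2 Y, q A, p B)] of [x^3 + y^3 = a^6 + b^6].  The forms
    come from the elliptic fibration [x - a^2 = t (b^2 - y)]: for [t = s^4] the
    fibre contains the trivial points [x = a^2], [y = b^2], [b = ± s a], and the
    double of their difference gives [A], [B], [X], [Y] at [m / n = s^6].
    If [p] and [q] are coprime, [30] divides [p] and [37] divides neither [p]
    nor [q], then [q A] and [p B] are coprime.  For [p / q] near [1] both
    [X] and [Y] are positive, which settles the plus sign with [q = p + 1]; for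
    [p / q] large [X < 0 < Y], which settles the minus sign with [q = 1]. *)

Set Implicit Arguments.
Unset Strict Implicit.
Unset Printing Implicit Defensive.

Import Order.TTheory GRing.Theory Num.Theory.
Local Open Scope classical_set_scope.
Local Open Scope ring_scope.

Lemma infinite_set_unbounded (T : choiceType) (S : set T) (g : T -> nat) :
  (forall k : nat, exists2 q, S q & (k <= g q)%N) -> infinite_set S.
Proof.
move=> unb /finite_seqP[s Ss].
have [q Sq] := unb (\max_(i <- s) g i).+1.
rewrite ltnNge (@leq_bigmax_seq _ s xpredT g q) //.
by move: Sq; rewrite Ss.
Qed.

(** All four terms sum to zero, so complementary subsets have opposite sums. Only single terms and
    the three pairs containing [x ^+ 3] need checking. *)
Lemma no_vanishing_partial_sum_intro (s t : bool) (k : nat) (x y a b : int) :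
  x ^+ 3 + (-1) ^+ s * y ^+ 3 = a ^+ k + (-1) ^+ t * b ^+ k ->
  x != 0 -> y != 0 -> a != 0 -> b != 0 ->
  x ^+ 3 != a ^+ k -> x ^+ 3 != (-1) ^+ t * b ^+ k ->
  x ^+ 3 + (-1) ^+ s * y ^+ 3 != 0 ->
  no_vanishing_partial_sum s t k x y a b.
Proof.
move=> E x0 y0 a0 b0 xa xb xy A A0 AT.
have x3 : x ^+ 3 != 0 by rewrite expf_neq0.
have y3 : (-1) ^+ s * y ^+ 3 != 0 by rewrite mulf_neq0 ?signr_eq0 ?expf_neq0.
have a3 : a ^+ k != 0 by rewrite expf_neq0.
have b3 : (-1) ^+ t * b ^+ k != 0 by rewrite mulf_neq0 ?signr_eq0 ?expf_neq0.
have memA (i j : 'I_4) : val i = val j -> (i \in A) = (j \in A).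
  by move=> /val_inj ->.
rewrite big_mkcond !big_ord_recl big_ord0 !(tnth_nth 0) /=.
move: (x ^+ 3) ((-1) ^+ s * y ^+ 3) (a ^+ k) ((-1) ^+ t * b ^+ k)
  E x3 y3 a3 b3 xa xb xy => X Y U V {x y a b x0 y0 a0 b0} E *.
case: (boolP (ord0 \in A)) => i0; case: (boolP (lift ord0 ord0 \in A)) => i1;
case: (boolP (lift ord0 (lift ord0 ord0) \in A)) => i2;
case: (boolP (lift ord0 (lift ord0 (lift ord0 ord0)) \in A)) => i3;
  try lia.
(* Of the sixteen membership patterns, only the full and the empty set remain. *)
- case/negP: AT; apply/eqP/finset.setP=> -[[|[|[|[|//]]]] lt_i]; rewrite inE.
  + by rewrite -[RHS]i0; apply: memA.
  + by rewrite -[RHS]i1; apply: memA.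
  + by rewrite -[RHS]i2; apply: memA.
  + by rewrite -[RHS]i3; apply: memA.
- case/negP: A0; apply/eqP/finset.setP=> -[[|[|[|[|//]]]] lt_i]; rewrite inE.
  + by rewrite -[RHS](negbTE i0); apply: memA.
  + by rewrite -[RHS](negbTE i1); apply: memA.
  + by rewrite -[RHS](negbTE i2); apply: memA.
  + by rewrite -[RHS](negbTE i3); apply: memA.
Qed.

(** * The parametric identity *)

Definition quad (m n : int) : int :=
  23 * m ^+ 2 + 50 * m * n - 37 * n ^+ 2.

Definition quart (m n : int) : int :=
  1369 * n ^+ 4 - 580 * n ^+ 3 * m + 78 * n ^+ 2 * m ^+ 2
  + 3020 * n * m ^+ 3 - 2591 * m ^+ 4.

Lemma quart_quad_identity (m n : int) :
  n * quart m n ^+ 3 + m * quart n m ^+ 3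
  = n * quad m n ^+ 6 + m * quad n m ^+ 6.
Proof. by rewrite /quart /quad; ring. Qed.

Lemma param_identity (p q : int) (m := p ^+ 6) (n := q ^+ 6) :
  (q ^+ 2 * quart m n) ^+ 3 + (p ^+ 2 * quart n m) ^+ 3
  = (q * quad m n) ^+ 6 + (p * quad n m) ^+ 6.
Proof.
have := quart_quad_identity m n.
move: (quart m n) (quart n m) (quad m n) (quad n m) => x y a b.
by move=> E; apply: etrans (etrans E _); rewrite /m /n; ring.
Qed.

Lemma quart_sub_quad (m n : int) :
  quart m n - quad m n ^+ 2
  = 240 * m * (n - m) * (13 * n ^+ 2 + 10 * n * m + 13 * m ^+ 2).
Proof. by rewrite /quart /quad; ring. Qed.

(** * Coprimality of the parametrized values *)

Lemma coprimez_addMr (d u c : int) : coprimez d (u + c * d) = coprimez d u.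
Proof. by rewrite /coprimez addrC gcdzMDl. Qed.

Lemma coprimez_dvd (c d e : int) : (c %| e)%Z -> coprimez d e -> coprimez d c.
Proof. by move=> /dvdzP[u ->]; rewrite coprimezMr => /andP[]. Qed.

(** Modulo [p] the form reduces to [- 37 * n ^+ 2]. *)
Lemma coprimez_quad (p m n : int) :
  coprimez p 37 -> (p %| m)%Z -> coprimez p n ->
  coprimez p (quad m n).
Proof.
move=> p37 /dvdzP[u ->] pn.
have -> : quad (u * p) n
    = - (37 * n ^+ 2) + (23 * u ^+ 2 * p + 50 * u * n) * p.
  by rewrite /quad; ring.
by rewrite coprimez_addMr coprimezN coprimezMr p37 coprimezXr.
Qed.

(* The two quadratic forms differ by [60 (m - n) (m + n)], and modulo [m - n]
   and [m + n] the first one is [36 m ^+ 2] and [- 64 m ^+ 2]. *)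
Lemma coprimez_quad_swap (m n : int) :
  coprimez (quad m n) 30 -> coprimez (quad m n) m ->
  coprimez (quad m n) (quad n m).
Proof.
move=> c30 cm.
have c2 : coprimez (quad m n) 2 by apply: coprimez_dvd c30.
have c3 : coprimez (quad m n) 3 by apply: coprimez_dvd c30.
have cdiv (e c : int) : coprimez (quad m n) e ->
    (exists u v, e = u * c + v * quad m n) -> coprimez (quad m n) c.
  move=> ce [u [v E]]; move: ce; rewrite E coprimez_addMr.
  by rewrite coprimezMr => /andP[].
have cB : coprimez (quad m n) (m - n).
  apply: (cdiv (2 ^+ 2 * 3 ^+ 2 * m ^+ 2)).
    by rewrite 2!coprimezMr (coprimezXr _ c2) (coprimezXr _ c3) coprimezXr.
  by exists (13 * m - 37 * n), 1; rewrite /quad; ring.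
have cD : coprimez (quad m n) (m + n).
  apply: (cdiv (2 ^+ 6 * m ^+ 2)).
    by rewrite coprimezMr (coprimezXr _ c2) coprimezXr.
  by exists (87 * m - 37 * n), (-1); rewrite /quad; ring.
have -> : quad n m = - (2 * 30 * (m - n) * (m + n)) + 1 * quad m n.
  by rewrite /quad; ring.
by rewrite coprimez_addMr coprimezN !coprimezMr c2 c30 cB cD.
Qed.

Lemma param_coprime (p q : int) (m := p ^+ 6) (n := q ^+ 6) :
  (30 %| p)%Z -> coprimez p q -> coprimez p 37 -> coprimez q 37 ->
  coprimez (q * quad m n) (p * quad n m).
Proof.
move=> p30 pq p37 q37; have qp : coprimez q p by rewrite coprimez_sym.
have pm : (p %| m)%Z by rewrite /m exprS dvdz_mulr.
have qn : (q %| n)%Z by rewrite /n exprS dvdz_mulr.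
have pA : coprimez p (quad m n) by apply: coprimez_quad => //; apply: coprimezXr.
have qB : coprimez q (quad n m) by apply: coprimez_quad => //; apply: coprimezXr.
rewrite coprimezMl !coprimezMr qp qB coprimez_sym pA /=.
apply: coprimez_quad_swap.
  (* Being coprime to [p], [quad m n] is coprime to the divisor 30 of [p] and to [m = p ^+ 6]. *)
  by apply: coprimez_dvd p30 _; rewrite coprimez_sym.
by rewrite coprimezXr // coprimez_sym.
Qed.

Lemma nontrivial_solution_intro (s : bool) (x y a b : int) :
  [/\ 0 < x, 0 < y, 0 < a & 0 < b] ->
  x ^+ 3 + (-1) ^+ s * y ^+ 3 = a ^+ 6 + b ^+ 6 -> coprimez a b ->
  x ^+ 3 != a ^+ 6 -> x ^+ 3 != b ^+ 6 ->
  nontrivial_solution s false 6 x y a b.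
Proof.
move=> [x0 y0 a0 b0] E ab xa xb; have bE : (-1) ^+ false * b ^+ 6 = b ^+ 6 by rewrite expr0 mul1r.
split; rewrite ?bE //; first by rewrite (eqP ab) gcdz1.
by apply: no_vanishing_partial_sum_intro;
  rewrite ?bE ?E // gt_eqF // addr_gt0 ?exprn_gt0.
Qed.

(** Cubing is injective on nonnegative integers, and [a ^+ 6] is the cube of [a ^+ 2]. *)
Lemma expr3_neq_expr6 (x a : int) :
  0 <= x -> (x ^+ 3 != a ^+ 6) = (x != a ^+ 2).
Proof.
move=> x0.
by rewrite -[a ^+ 6]/(a ^+ (2 * 3)) exprM eqrXn2 // sqr_ge0.
Qed.

(** * The plus sign *)

Lemma quart_gt_quad (m n : int) : 0 < m -> m < n -> quad m n ^+ 2 < quart m n.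
Proof.
move=> m0 mn; have n0 := lt_trans m0 mn.
rewrite -subr_gt0 quart_sub_quad !mulr_gt0 ?subr_gt0 //.
by rewrite !addr_gt0 ?mulr_gt0 ?exprn_gt0.
Qed.

(** At [m = n = 1] the quartic forms equal 1296 and the quadratic ones 36; a ratio [n / m] up to
    21/20 is close enough to 1 to keep all of them positive. *)
Lemma quart_quad_gt0 (m n : int) :
  0 < m -> m < n -> 20 * n <= 21 * m ->
  [/\ 0 < quart m n, 0 < quart n m, 0 < quad m n & 0 < quad n m].
Proof.
move=> m0 mn nm; have n0 := lt_trans m0 mn.
have mm : 0 < m ^+ 2 by rewrite exprn_gt0.
have m_mn : m ^+ 2 <= m * n by rewrite expr2 ler_pM2l // ltW.
have mn_nn : m * n <= n ^+ 2 by rewrite expr2 ler_pM2r // ltW.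
have nn_mn : 20 * n ^+ 2 <= 21 * (m * n).
  by rewrite expr2 !mulrA ler_pM2r.
split.
- by apply: le_lt_trans (quart_gt_quad m0 mn); rewrite sqr_ge0.
(* Every monomial of [quart n m] except the nonnegative [78 * m ^+ 2 * n ^+ 2] is compared with
   [m ^+ 4]; the resulting coefficient exceeds 630. *)
- have n4 : (20 * n) ^+ 4 <= (21 * m) ^+ 4.
    by rewrite lerXn2r // nnegrE mulr_ge0 // ltW.
  have m3n : 20 * (m ^+ 3 * n) <= 21 * m ^+ 4.
    by rewrite [m ^+ 4]exprSr mulrCA [leRHS]mulrCA ler_pM2l ?exprn_gt0.
  have mn3 : m ^+ 4 <= m * n ^+ 3.
    by rewrite exprS ler_pM2l // lerXn2r // ?nnegrE ltW.
  have m4 : 0 < m ^+ 4 by rewrite exprn_gt0.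
  have mn2 : 0 <= m ^+ 2 * n ^+ 2 by rewrite mulr_ge0 ?sqr_ge0.
  rewrite /quart; lra.
- rewrite /quad; lra.
- rewrite /quad; lra.
Qed.

Lemma plus_solution (p : int) :
  1000 <= p -> (30 %| p)%Z -> coprimez p 37 -> coprimez (p + 1) 37 ->
  exists x y a b : int, [/\ [/\ 0 < x, 0 < y, 0 < a & 0 < b],
    nontrivial_solution false false 6 x y a b & p <= b].
Proof.
pose q := p + 1; pose m := p ^+ 6; pose n := q ^+ 6.
move=> p1000 p30 p37 q37.
have pq : coprimez p q.
  by rewrite /q addrC -[X in 1 + X]mul1r coprimez_addMr coprimezE coprimen1.
have cop := param_coprime p30 pq p37 q37; rewrite -/m -/n in cop.
have p0 : 0 < p by lia.
have q0 : 0 < q by lia.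
have m0 : 0 < m by rewrite exprn_gt0.
have mn : m < n by rewrite ltrXn2r // ?nnegrE; lia.
have nm : 20 * n <= 21 * m.
  (* Since [p >= 1000], [q / p] is at most 1001/1000, whose sixth power is below 21/20. *)
  have : (1000 * q) ^+ 6 <= (1001 * p) ^+ 6 by rewrite lerXn2r // ?nnegrE; lia.
  by rewrite !exprMn -/m -/n; lia.
have [X0 Y0 A0 B0] := quart_quad_gt0 m0 mn nm.
have XA := quart_gt_quad m0 mn.
have x0 : 0 < q ^+ 2 * quart m n by rewrite mulr_gt0 ?exprn_gt0.
have pos : [/\ 0 < q ^+ 2 * quart m n, 0 < p ^+ 2 * quart n m,
    0 < q * quad m n & 0 < p * quad n m].
  by split=> //; rewrite mulr_gt0 // ?exprn_gt0.
exists (q ^+ 2 * quart m n), (p ^+ 2 * quart n m), (q * quad m n).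
exists (p * quad n m); split=> //; last by rewrite ler_peMr // ltW.
apply: nontrivial_solution_intro => //.
- by rewrite mul1r; apply: param_identity.
- by rewrite expr3_neq_expr6 ?ltW // exprMn gt_eqF // ltr_pM2l ?exprn_gt0.
(* Equality would make [q] divide [(p * quad n m) ^+ 2], to which it is coprime, although
   [q > 1]. *)
rewrite expr3_neq_expr6 ?ltW //; apply/eqP => E.
have : coprimez q ((p * quad n m) ^+ 2).
  by apply: coprimezXr; move: cop; rewrite coprimezMl => /andP[].
rewrite -E exprS -mulrA coprimezMr => /andP[+ _].
by rewrite /coprimez gcdzz => /eqP; lia.
Qed.

(** * The minus sign *)

Lemma quart_quad_sign (m : int) : 64 <= m ->
  [/\ 0 < quart 1 m, 0 < - quart m 1, 0 < quad m 1 & 0 < - quad 1 m].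
Proof.
move=> m64; have m0 : 0 < m by apply: lt_le_trans m64.
(* These bounds let the leading terms, with coefficients 1369, -2591, 23 and -37, decide the signs;
   64 is [2 ^+ 6], the least [p ^+ 6] for [p >= 2]. *)
have m2 : 64 * m <= m ^+ 2 by rewrite expr2 ler_pM2r.
have m3 : 64 * m ^+ 2 <= m ^+ 3 by rewrite [m ^+ 3]exprS ler_pM2r ?exprn_gt0.
have m4 : 64 * m ^+ 3 <= m ^+ 4 by rewrite [m ^+ 4]exprS ler_pM2r ?exprn_gt0.
by rewrite /quart /quad !expr1n; split; lra.
Qed.

Lemma minus_solution (p : int) :
  2 <= p -> (30 %| p)%Z -> coprimez p 37 ->
  exists x y a b : int, [/\ [/\ 0 < x, 0 < y, 0 < a & 0 < b],
    nontrivial_solution true false 6 x y a b & p <= b].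
Proof.
pose m := p ^+ 6; move=> p2 p30 p37.
have cop : coprimez (quad m 1) (p * - quad 1 m).
  have := @param_coprime p 1 p30 _ p37 _.
  by rewrite !expr1n !mul1r mulrN coprimezN; apply; rewrite coprimezE ?coprimen1.
have id : quart m 1 ^+ 3 + (p ^+ 2 * quart 1 m) ^+ 3
    = quad m 1 ^+ 6 + (p * quad 1 m) ^+ 6.
  by have := param_identity p 1; cbv zeta; rewrite !expr1n !mul1r.
have p0 : 0 < p by lia.
have m64 : 64 <= m.
  have : 2 ^+ 6 <= m by rewrite lerXn2r // nnegrE ltW.
  by move=> pow2; lra.
have [Y0 X0 A0 B0] := quart_quad_sign m64.
have E : (p ^+ 2 * quart 1 m) ^+ 3 + (-1) ^+ true * (- quart m 1) ^+ 3
    = quad m 1 ^+ 6 + (p * - quad 1 m) ^+ 6.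
  rewrite expr1 mulN1r mulrN -[(- (p * _)) ^+ 6]/((- (p * _)) ^+ (2 * 3)).
  rewrite exprM sqrrN -exprM -id; ring.
have a6 : 0 < quad m 1 ^+ 6 by rewrite exprn_gt0.
have b6 : 0 < (p * - quad 1 m) ^+ 6 by rewrite exprn_gt0 ?mulr_gt0.
have y3 : 0 < (- quart m 1) ^+ 3 by rewrite exprn_gt0.
have pos : [/\ 0 < p ^+ 2 * quart 1 m, 0 < - quart m 1,
    0 < quad m 1 & 0 < p * - quad 1 m].
  by split=> //; rewrite mulr_gt0 // exprn_gt0.
(* The two cubes are exchanged so that the negative one becomes [- y ^+ 3]; the sign of [b] is lost
   in the sixth power. *)
exists (p ^+ 2 * quart 1 m), (- quart m 1), (quad m 1), (p * - quad 1 m).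
split=> //; last by rewrite ler_peMr // ltW.
apply: nontrivial_solution_intro => //.
(* Here [x ^+ 3] is the sum of the positive numbers [a ^+ 6], [b ^+ 6] and [y ^+ 3], so it exceeds
   each of them. *)
- by rewrite expr1 mulN1r in E; lia.
- by rewrite expr1 mulN1r in E; lia.
Qed.

Theorem mainTheorem5 (s : bool) :
  infinite_set [set q : int * int * int * int |
    let: (x, y, a, b) := q in
    [/\ 0 < x, 0 < y, 0 < a & 0 < b] /\
    nontrivial_solution s false 6 x y a b].
Proof.
(* Unboundedness is measured by [b], which is at least [p]. *)
apply: (@infinite_set_unbounded _ _ (fun q => `|q.2|%N)) => k.
(* As 1110 = 30 * 37 and 1140 = 30 * 38, [p] is a multiple of 30 above 1000, with [p] and [p + 1]
   congruent to 30 and 31 modulo 37. *)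
pose p : int := 1110 * k%:Z + 1140.
have p30 : (30 %| p)%Z.
  by apply/dvdzP; exists (37 * k%:Z + 38); rewrite /p; ring.
have p37 : coprimez p 37.
  rewrite coprimez_sym (_ : p = 30 + (30 * k%:Z + 30) * 37); last first.
    by rewrite /p; ring.
  by rewrite coprimez_addMr.
have q37 : coprimez (p + 1) 37.
  rewrite coprimez_sym (_ : p + 1 = 31 + (30 * k%:Z + 30) * 37); last first.
    by rewrite /p; ring.
  by rewrite coprimez_addMr.
have [x [y [a [b [pos sol pb]]]]] :
    exists x y a b : int, [/\ [/\ 0 < x, 0 < y, 0 < a & 0 < b],
      nontrivial_solution s false 6 x y a b & p <= b].
  case: s; first by apply: minus_solution => //; lia.
  by apply: plus_solution => //; lia.
by exists (x, y, a, b) => //=; lia.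
Qed.
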